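(* For any apex graph $A$ and any $A$-minor-free graph $G$, $\mathrm{ttw}(G)\leq g(A,2)$.
   Context: All graphs are finite, simple and undirected. A graph $A$ is apex if $A-z$ is planar for some vertex $z\in V(A)$. A graph $A$ is a minor of $G$ if a graph isomorphic to $A$ can be obtained from a subgraph of $G$ by contracting edges; $G$ is $A$-minor-free if $A$ is not a minor of $G$. The radius of a connected graph $G$ is $\min_{\alpha\in V(G)}\max_{v\in V(G)}\mathrm{dist}_G(\alpha,v)$. For an apex graph $A$ and integer $r\geq0$, $g(A,r)$ denotes the maximum treewidth of an $A$-minor-free graph with radius at most $r$ (it is known that this maximum is finite). A tree-decomposition of $G$ is a tree $T$ with bags $(B_x\subseteq V(G):x\in V(T))$ such that every vertex lies in some bag, each edge has both ends in some bag, and for each vertex $v$ the set $\{x:v\in B_x\}$ induces a connected subtree of $T$. The tree-treewidth $\mathrm{ttw}(G)$ is the minimum integer $k$ such that $G$ has a tree-decomposition $(B_x:x\in V(T))$ with $\mathrm{tw}(G[B_x])\leq k$ for every node $x\in V(T)$, where $\mathrm{tw}$ denotes treewidth. *)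

(* Defs.v *)
From HB Require Import structures.
From mathcomp Require Import all_boot all_order all_algebra.
From mathcomp Require Import all_classical all_reals all_analysis.

Set Implicit Arguments.
Unset Strict Implicit.
Unset Printing Implicit Defensive.

Import Order.TTheory GRing.Theory Num.Theory.
Import numFieldNormedType.Exports.

Record sgraph := SGraph {
  vertex :> finType;
  adj : rel vertex;
  adj_sym : symmetric adj;
  adj_irr : irreflexive adj }.

Notation "x -- y" := (adj x y) (at level 30, no associativity).

Section Induced.
Variables (G : sgraph) (S : {set G}).
Definition induced_rel : rel {x : G | x \in S} :=
  fun x y => val x -- val y.
Lemma induced_sym : symmetric induced_rel.
Proof. by move=> x y; rewrite /induced_rel adj_sym. Qed.
Lemma induced_irr : irreflexive induced_rel.
Proof. by move=> x; rewrite /induced_rel adj_irr. Qed.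
Definition induced_subgraph : sgraph := SGraph induced_sym induced_irr.
End Induced.

(* The contraction of the edge uv: the vertex v is merged into u; loops and   *)
(* parallel edges disappear.                                                  *)
Section Contract.
Variables (G : sgraph) (u v : G).
Definition merge_ends (x : G) : G := if x == v then u else x.
Definition contract_rel : rel {x : G | x != v} :=
  fun a b => (a != b) &&
    [exists x : G, exists y : G,
       [&& merge_ends x == val a, merge_ends y == val b & x -- y]].
Lemma contract_sym : symmetric contract_rel.
Proof.
move=> a b; rewrite /contract_rel eq_sym; congr (_ && _).
by apply/existsP/existsP => -[x /existsP[y /and3P[xa yb xy]]]; exists y;
  apply/existsP; exists x; rewrite xa yb adj_sym xy.
Qed.
Lemma contract_irr : irreflexive contract_rel.
Proof. by move=> a; rewrite /contract_rel eqxx. Qed.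
Definition contract : sgraph := SGraph contract_sym contract_irr.
End Contract.

Inductive contracts_to (G : sgraph) : sgraph -> Prop :=
| contracts_refl : contracts_to G G
| contracts_step (H : sgraph) (u v : H) :
    contracts_to G H -> u -- v -> contracts_to G (contract u v).

Definition isomorphic (G H : sgraph) : Prop :=
  exists2 f : G -> H, bijective f & {mono f : x y / x -- y}.

(* H is, up to isomorphism, a (not necessarily induced) subgraph of G. *)
Definition subgraph (H G : sgraph) : Prop :=
  exists2 f : H -> G, injective f & {homo f : x y / x -- y}.

Definition minor (A G : sgraph) : Prop :=
  exists H K : sgraph,
    [/\ subgraph H G, contracts_to H K & isomorphic K A].

Definition minor_free (A G : sgraph) : Prop := ~ minor A G.

Section Planar.
Local Open Scope classical_set_scope.
Local Open Scope ring_scope.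

Definition is_arc (R : realType) (p q : R * R) (S : set (R * R)) : Prop :=
  exists f : R -> R * R,
    [/\ {within `[0, 1], continuous f}, {in `[0, 1] &, injective f},
        f 0 = p, f 1 = q & f @` `[0, 1] = S].

(* A drawing sends the vertices to distinct points p of the plane and each    *)
(* edge uv to an arc c u v between its ends; arcs pass through no other       *)
(* vertex, and two different edges meet at most in common ends.               *)
Definition planar (R : realType) (G : sgraph) : Prop :=
  exists (p : G -> R * R) (c : G -> G -> set (R * R)),
    [/\ injective p,
        forall u v, u -- v -> is_arc (p u) (p v) (c u v) /\ c u v = c v u,
        forall u v w, u -- v -> c u v (p w) -> w \in [set u; v]%SET
      & forall u v u' v', u -- v -> u' -- v' ->
          [set u; v]%SET != [set u'; v']%SET ->
          forall z, c u v z -> c u' v' z ->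
          exists2 w, w \in ([set u; v] :&: [set u'; v'])%SET & z = p w].

Definition apex (R : realType) (A : sgraph) : Prop :=
  exists z : A, planar R (induced_subgraph [set~ z]%SET).

End Planar.

(* The null graph is not connected. *)
Definition connected_graph (G : sgraph) : Prop :=
  (0 < #|G|)%N /\ forall x y : G, connect (@adj G) x y.

Definition acyclic (G : sgraph) : Prop :=
  forall c : seq G, ucycle (@adj G) c -> (size c <= 2)%N.

Definition is_tree (T : sgraph) : Prop := connected_graph T /\ acyclic T.

Definition walk (G : sgraph) (n : nat) (x y : G) : bool :=
  [exists p : n.-tuple G, path (@adj G) x p && (last x p == y)].

(* The least length of a walk from x to y; takes the value #|G| when there is *)
(* none, since otherwise the distance is less than #|G|.                      *)
Definition dist (G : sgraph) (x y : G) : nat :=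
  find (fun n => walk n x y) (iota 0 #|G|).

(* As dist is at most #|G|, the default value #|G| of the minimum is neutral. *)
Definition graph_radius (G : sgraph) : nat :=
  \big[minn/#|G|]_(a : G) \max_(v : G) dist a v.

Definition tree_decomposition (G T : sgraph) (B : T -> {set G}) : Prop :=
  [/\ is_tree T,
      forall v : G, exists x, v \in B x,
      forall u v : G, u -- v -> exists x, (u \in B x) && (v \in B x)
    & forall v : G, connected_graph (induced_subgraph [set x | v \in B x]%SET)].

Lemma trivial_tree_decomposition (G : sgraph) :
  exists (T : sgraph) (B : T -> {set G}),
    tree_decomposition B /\ forall x, B x = [set: G]%SET.
Proof.
have s0 : symmetric (fun _ _ : unit => false) by [].
have i0 : irreflexive (fun _ _ : unit => false) by [].
exists (SGraph s0 i0), (fun=> [set: G]%SET); split=> //; split.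
- split; first by split=> [|[] []]; rewrite ?card_unit ?connect0.
  by case=> [|x [|y c]].
- by move=> v; exists tt; rewrite inE.
- by move=> u v _; exists tt; rewrite !inE.
- move=> v; split=> [|[[] hx] [[] hy]].
    have tt_in : tt \in [set x : SGraph s0 i0 | v \in [set: G]]%SET.
      by rewrite !inE.
    by apply/card_gt0P; exists (exist _ tt tt_in).
  by rewrite (bool_irrelevance hx hy) connect0.
Qed.

Definition has_max_bag (G : sgraph) (m : nat) : Prop :=
  exists (T : sgraph) (B : T -> {set G}),
    tree_decomposition B /\ (\max_(x : T) #|B x|)%N = m.

Lemma has_max_bag_ex (G : sgraph) : exists m, `[< has_max_bag G m >].
Proof.
have [T [B [TB _]]] := trivial_tree_decomposition G.
by exists (\max_(x : T) #|B x|)%N; apply/asboolP; exists T, B.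
Qed.

(* The minimum, over all tree-decompositions, of the maximum size of a bag    *)
(* minus 1. It is -1 for the null graph, hence the type int.                  *)
Definition treewidth (G : sgraph) : int :=
  ((ex_minn (has_max_bag_ex G))%:Z - 1)%R.

Definition has_bags_of_treewidth_le (G : sgraph) (k : int) : Prop :=
  exists (T : sgraph) (B : T -> {set G}),
    tree_decomposition B /\ forall x : T, (treewidth (induced_subgraph (B x)) <= k)%R.

Lemma has_bags_of_treewidth_le_ex (G : sgraph) :
  exists m : nat, `[< has_bags_of_treewidth_le G (m%:Z - 1)%R >].
Proof.
have [T [B [TB BT]]] := trivial_tree_decomposition G.
exists (ex_minn (has_max_bag_ex (induced_subgraph [set: G]%SET))).
by apply/asboolP; exists T, B; split=> // x; rewrite BT.
Qed.

(* The least integer k such that has_bags_of_treewidth_le G k: as treewidths  *)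
(* are at least -1 and trees have a node, every such k is m - 1 with m : nat. *)
Definition tree_treewidth (G : sgraph) : int :=
  ((ex_minn (has_bags_of_treewidth_le_ex G))%:Z - 1)%R.

Definition minor_free_radius_le (A : sgraph) (r : nat) (H : sgraph) : Prop :=
  [/\ minor_free A H, connected_graph H & (graph_radius H <= r)%N].

(* k = g(A, r), the maximum treewidth of an A-minor-free graph with radius at *)
(* most r.                                                                    *)
Definition is_g (A : sgraph) (r : nat) (k : int) : Prop :=
  (exists2 H, minor_free_radius_le A r H & treewidth H = k) /\
  (forall H, minor_free_radius_le A r H -> (treewidth H <= k)%R).

(* Main.v *)
(* Choose a base vertex in every component of G and split G into layers by    *)
(* distance to the bases. The classes of layer i, two vertices being in the   *)
(* same class when they are joined by a path in the layers >= i, form a       *)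
(* forest, and the bags (a class together with its parent class) give a       *)
(* tree-decomposition of G. A bag at layer i lies in the layers i - 1 and i,  *)
(* so contracting the layers <= i - 2 of its component to the base yields a   *)
(* minor of G of radius at most 2 that contains the subgraph induced by the   *)
(* bag. This minor is A-minor-free, so its treewidth is at most g(A, 2).      *)

Require Import Defs.
From mathcomp Require Import all_boot all_order all_algebra.
From mathcomp Require Import all_classical all_reals all_analysis.
From mathcomp Require Import zify.

Set Implicit Arguments.
Unset Strict Implicit.
Unset Printing Implicit Defensive.

(** The neighbours in layer $i-1$ of a class in layer $i$ all lie in one class, because they are
    linked to each other through the given class inside the layers $\geq i-1$ ([same_below]). So
    every edge of $G$ lies within a class or between a class and its parent, hence in a bag. In the
    forest of classes, the bags that contain a vertex are those of its class and of the child
    classes, which form a star ([layer_tree_decomposition]).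

    The layers $\leq i-2$ of a component are connected through its base, so they can be contracted;
    every vertex of the layers $i-1$ and $i$ then reaches the base in at most two steps
    ([shrunk_radius]), and the bag survives ([bag_shrunk]). [treewidth_subgraph] passes the bound
    from this minor to the bag.

    Minors are handled as partial maps whose fibers are connected branch sets. Such models compose
    ([model_comp]) and are equivalent to minors ([minor_model], [model_minor]), so the minor is
    $A$-minor-free because $G$ is. *)

Lemma connect_homo (T T' : finType) (e : rel T) (e' : rel T') (f : T -> T') :
  (forall x y, e x y -> f x = f y \/ e' (f x) (f y)) ->
  forall x y, connect e x y -> connect e' (f x) (f y).
Proof.
move=> ef x y /connectP[p]; elim: p x => [|z p IHp] x /= => [_ ->|].
  exact: connect0.
case/andP=> /ef[-> | fxz] zp ylast; first exact: IHp.
exact: connect_trans (connect1 fxz) (IHp _ zp ylast).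
Qed.

(** Strong induction on [h] walks every element of [S] to [t]. Trees, subtrees of nodes, branch sets
    and the contracted graph are all shown to be connected in this way. *)
Lemma connect_by_descent (T : finType) (e : rel T) (S : pred T) (t : T)
    (h : T -> nat) :
  symmetric e ->
  (forall x, S x -> x != t -> exists y, [/\ S y, e x y & h y < h x]) ->
  forall x y, S x -> S y -> connect e x y.
Proof.
move=> e_sym descent.
have to_t x : S x -> connect e x t.
  have [n] := ubnP (h x); elim: n x => // n IHn x hx Sx.
  have [->|x't] := eqVneq x t; first exact: connect0.
  have [y [Sy exy hyx]] := descent x Sx x't.
  apply: connect_trans (connect1 exy) (IHn y _ Sy).
  by apply: leq_trans hyx _.
move=> x y Sx Sy; apply: connect_trans (to_t x Sx) _.
by rewrite (sym_connect_sym e_sym) to_t.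
Qed.

(** * Minor models *)

Definition fiber_rel (G : sgraph) (V : eqType) (phi : G -> V) : rel G :=
  fun x y => (phi x == phi y) && (x -- y).

(* phi is None outside the branch sets of the model. *)
Definition model (A G : sgraph) (phi : G -> option A) : Prop :=
  [/\ forall a, exists x, phi x = Some a,
      forall x y, phi x = phi y -> phi x -> connect (fiber_rel phi) x y
    & forall a b, a -- b -> exists x y,
        [/\ phi x = Some a, phi y = Some b & x -- y]].

Lemma subgraph_model (H G : sgraph) :
  subgraph H G -> exists phi : G -> option H, model phi.
Proof.
case=> f f_inj f_homo.
pose phi x := [pick h | f h == x].
have phi_f h : phi (f h) = Some h.
  by rewrite /phi; case: pickP => [k /eqP/f_inj->|/(_ h)/eqP].
have phiP x h : phi x = Some h -> x = f h.
  by rewrite /phi; case: pickP => // k /eqP<- [->].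
exists phi; split=> [a|x y|a b ab]; first by exists (f a).
  case phi_x: (phi x) => [h|] // /esym/phiP-> _.
  by rewrite (phiP _ _ phi_x) connect0.
by exists (f a), (f b); split=> //; exact: f_homo.
Qed.

Lemma adj_neq (G : sgraph) (x y : G) : x -- y -> x != y.
Proof. by apply: contraTneq => ->; rewrite adj_irr. Qed.

Lemma merge_ends_neq (G : sgraph) (u v x : G) :
  u != v -> merge_ends u v x != v.
Proof. by rewrite /merge_ends; case: (eqVneq x v). Qed.

(* Defs is needed in front of contract: MathComp-Analysis has a contract of   *)
(* the extended reals.                                                        *)
Definition merge_map (G : sgraph) (u v : G) (uv : u != v) (x : G) :
    Defs.contract u v :=
  exist _ (merge_ends u v x) (merge_ends_neq x uv).

Lemma merge_mapK (G : sgraph) (u v : G) (uv : u != v) :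
  cancel val (merge_map uv).
Proof.
by move=> a; apply: val_inj; rewrite /= /merge_ends (negPf (valP a)).
Qed.

Lemma contract_model (H : sgraph) (u v : H) :
  u -- v -> exists phi : H -> option (Defs.contract u v), model phi.
Proof.
move=> uv; have u'v := adj_neq uv; pose m := merge_map u'v.
have m_val : cancel val m := merge_mapK u'v.
exists (fun x => Some (m x)); split=> [a|x y [mxy] _|a b].
- by exists (val a); rewrite m_val.
- have fib_uv : fiber_rel (fun x => Some (m x)) u v.
    rewrite /fiber_rel uv andbT; apply/eqP; congr Some; apply: val_inj.
    by rewrite /= /merge_ends eqxx (negPf u'v).
  have fib_vu : fiber_rel (fun x => Some (m x)) v u.
    by move: fib_uv; rewrite /fiber_rel eq_sym adj_sym.
  move: mxy; rewrite /merge_ends; case: (eqVneq x v) => [->|_].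
    case: (eqVneq y v) => [-> _|_ <-]; [exact: connect0|exact: connect1].
  case: (eqVneq y v) => [-> ->|_ ->]; [exact: connect1|exact: connect0].
- case/andP=> _ /existsP[x /existsP[y /and3P[/eqP xa /eqP yb xy]]].
  by exists x, y; split=> //; congr Some; apply: val_inj.
Qed.

Lemma model_comp (A Q G : sgraph) (phi : G -> option Q) (psi : Q -> option A) :
  model phi -> model psi -> model (fun x => obind psi (phi x)).
Proof.
move=> [phi_surj phi_conn phi_edge] [psi_surj psi_conn psi_edge].
pose chi x := obind psi (phi x).
have chi_conn x y : phi x = phi y -> phi x -> connect (fiber_rel chi) x y.
  move=> xy phix; apply: connect_sub (phi_conn _ _ xy phix) => z w.
  by case/andP=> /eqP zw ez; rewrite connect1 // /fiber_rel /chi zw eqxx.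
(* A path of [Q] inside a branch set of [psi] is lifted: each of its edges comes from an edge of
   [G], and consecutive ones are linked inside a branch set of [phi]. *)
have path_conn p : forall b x y, path (fiber_rel psi) b p -> phi x = Some b ->
    phi y = Some (last b p) -> connect (fiber_rel chi) x y.
  elim: p => [|b1 p IHp] b x y /= => [_ xb yb|].
    by apply: chi_conn; rewrite xb ?yb.
  case/andP=> /andP[/eqP psib /phi_edge[x' [y' [x'b y'b1 x'y']]]] b1p xb yl.
  have xx' : connect (fiber_rel chi) x x' by apply: chi_conn; rewrite xb ?x'b.
  apply: connect_trans xx' _; apply: connect_trans (IHp _ _ _ b1p y'b1 yl).
  by apply: connect1; rewrite /fiber_rel /chi x'b y'b1 /= psib eqxx.
split=> [a|x y|a b /psi_edge[a' [b' [a'a b'b /phi_edge[x [y [xa yb xy]]]]]]].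
- have [b ba] := psi_surj a; have [x xb] := phi_surj b.
  by exists x; rewrite xb.
- case phi_x: (phi x) => [b|] //=; case phi_y: (phi y) => [b'|] /= bb' psib.
    have /connectP[p bp b'p] := psi_conn _ _ bb' psib.
    by apply: path_conn bp phi_x _; rewrite phi_y b'p.
  by rewrite bb' in psib.
- by exists x, y; rewrite xa yb.
Qed.

Lemma contracts_to_model (G H : sgraph) :
  contracts_to G H -> exists phi : G -> option H, model phi.
Proof.
elim=> [|{}H u v _ [phi phiM] /contract_model[psi psiM]].
  by apply: subgraph_model; exists id.
by exists (fun x => obind psi (phi x)); exact: model_comp.
Qed.

Lemma minor_model (A G : sgraph) :
  minor A G -> exists phi : G -> option A, model phi.
Proof.
case=> H [K [/subgraph_model[phi phiM] /contracts_to_model[psi psiM]]].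
case=> f [f' fK f'K] f_mono.
have [|chi chiM] := @subgraph_model A K.
  by exists f' => [|x y xy]; [exact: can_inj f'K | rewrite -f_mono !f'K].
exists (fun x => obind chi (obind psi (phi x))).
by apply: model_comp chiM; exact: model_comp.
Qed.

Lemma contracts_to_trans (G H K : sgraph) :
  contracts_to G H -> contracts_to H K -> contracts_to G K.
Proof.
by move=> GH; elim=> // {}K u v _; apply: contracts_step.
Qed.

(** Induction on the order of [H]. If [phi] is injective, it is an isomorphism; otherwise some edge
    lies inside a fiber, and [phi] factors through its contraction. *)
Lemma quotient_contracts_to (H A : sgraph) (phi : H -> A) :
  (forall a, exists x, phi x = a) ->
  (forall x y, phi x = phi y -> connect (fiber_rel phi) x y) ->
  (forall x y, x -- y -> phi x = phi y \/ phi x -- phi y) ->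
  (forall a b, a -- b -> exists x y, [/\ phi x = a, phi y = b & x -- y]) ->
  exists2 K, contracts_to H K & isomorphic K A.
Proof.
have [n] := ubnP #|H|; elim: n H phi => // n IHn H phi leHn surj conn homo edge.
have [/injectiveP phi_inj|] := boolP (injectiveb phi).
  exists H; first exact: contracts_refl.
  have surjP a : exists x, phi x == a by have [x <-] := surj a; exists x.
  exists phi.
    exists (fun a => xchoose (surjP a)) => [x|a];
      last exact/eqP/(xchooseP (surjP a)).
    exact/phi_inj/eqP/(xchooseP (surjP (phi x))).
  move=> x y; apply/idP/idP => [/edge[x' [y' [/phi_inj-> /phi_inj->]]]|xy] //.
  by have [/phi_inj xy'|] := homo _ _ xy; first by rewrite xy' adj_irr in xy.
case/injectivePn=> x0 [y0 y'x0 phi_xy0].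
(* The first edge of a path in the fiber that joins [x0] to [y0]. *)
have [u [v [uv phi_uv]]] : exists u v, u -- v /\ phi u = phi v.
  case/connectP: (conn _ _ phi_xy0).
  move=> -[_ /= y0E|v p /andP[/andP[/eqP phiv x0v] _] _].
    by rewrite y0E eqxx in y'x0.
  by exists x0, v.
have u'v := adj_neq uv; pose m := merge_map u'v.
have m_val : cancel val m := merge_mapK u'v.
have m_adj x y : x -- y -> m x = m y \/ m x -- m y.
  move=> xy; have [->|m'xy] := eqVneq (m x) (m y); [by left | right].
  rewrite /adj /= /contract_rel m'xy.
  by apply/existsP; exists x; apply/existsP; exists y; rewrite !eqxx.
pose phi' (a : Defs.contract u v) := phi (val a).
have phi'm x : phi' (m x) = phi x.
  by rewrite /phi' /= /merge_ends; case: eqP => // ->.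
have [| | | | |K HK KA] := IHn (Defs.contract u v) phi'.
- rewrite -ltnS; apply: leq_trans leHn; rewrite ltnS card_sig.
  by rewrite cardC1 prednK //; apply/card_gt0P; exists v.
- by move=> a; have [x <-] := surj a; exists (m x).
- move=> a b /conn ab; rewrite -(m_val a) -(m_val b).
  apply: connect_homo ab => x y /andP[/eqP phixy xy].
  have [|mxy] := m_adj _ _ xy; [by left | right].
  by rewrite /fiber_rel !phi'm phixy eqxx.
- move=> a b /andP[_ /existsP[x /existsP[y /and3P[/eqP xa /eqP yb xy]]]].
  rewrite -(m_val a) -(m_val b) !phi'm /=.
  have ->: val a = merge_ends u v x by [].
  have ->: val b = merge_ends u v y by [].
  by have := homo _ _ xy; rewrite -!(phi'm x) -!(phi'm y).
- move=> a b ab; have [x [y [xa yb xy]]] := edge _ _ ab.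
  exists (m x), (m y); rewrite !phi'm; split=> //.
  have [mxy|//] := m_adj _ _ xy.
  by move: ab; rewrite -xa -yb -(phi'm x) mxy phi'm adj_irr.
by exists K => //; apply: contracts_to_trans HK; apply: contracts_step uv; left.
Qed.

(** The subgraph to contract keeps only edges within a branch set or between branch sets adjacent in
    [A], as any other edge would survive as an edge that [A] does not have. Pairing a vertex with
    its image makes the partial map [phi] total. *)
Lemma model_minor (A G : sgraph) (phi : G -> option A) : model phi -> minor A G.
Proof.
move=> [surj conn edge].
pose V := {z : G * A | phi z.1 == Some z.2}.
pose e : rel V := fun z w => ((val z).1 -- (val w).1) &&
  (((val z).2 == (val w).2) || ((val z).2 -- (val w).2)).
have e_sym : symmetric e.
  by move=> z w; rewrite /e adj_sym eq_sym (adj_sym (val z).2).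
have e_irr : irreflexive e by move=> z; rewrite /e adj_irr.
pose H := SGraph e_sym e_irr.
have HP (z : H) : phi (val z).1 = Some (val z).2 by apply/eqP/(valP z).
have fst_inj (z w : H) : (val z).1 = (val w).1 -> z = w.
  case: z w => [[x a] xa] [[y b] yb] /= xy; apply: val_inj.
  by move: yb; rewrite /= -xy (eqP xa) => /eqP[->].
pose mk x a (xa : phi x = Some a) : H :=
  exist _ (x, a) (introT (eqP (x := phi x) (y := Some a)) xa).
have [| | | |K HK KA] := @quotient_contracts_to H A (fun z => (val z).2).
- by move=> a; have [x xa] := surj a; exists (mk x a xa).
- move=> z w zw; have phi_zw : phi (val z).1 = phi (val w).1 by rewrite !HP zw.
  have [|p] := connectP (conn _ _ phi_zw _); first by rewrite HP.
  elim: p z {zw phi_zw} => [|x p IHp] z /= => [_ wz|].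
    by rewrite (fst_inj _ _ wz) connect0.
  case/andP=> /andP[/eqP phi_zx zx] xp wx.
  have xz : phi x = Some (val z).2 by rewrite -phi_zx HP.
  apply: connect_trans (IHp (mk x _ xz) xp wx).
  by apply: connect1; rewrite /fiber_rel /= eqxx /adj /= /e /= zx eqxx.
- by move=> z w /andP[_ /orP[/eqP|]]; [left | right].
- move=> a b ab; have [x [y [xa yb xy]]] := edge _ _ ab.
  exists (mk x a xa), (mk y b yb); split=> //.
  by rewrite /adj /= /e /= xy ab orbT.
exists H, K; split=> //; exists (fun z => (val z).1)=> //.
by move=> z w /andP[].
Qed.

(** The preimages of the bags under the embedding [f] form a tree-decomposition of [H] on the same
    tree, and no bag grows since [f] is injective. *)
Lemma treewidth_subgraph (H G : sgraph) :
  subgraph H G -> (treewidth H <= treewidth G)%R.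
Proof.
case=> f f_inj f_homo; rewrite /treewidth.
case: ex_minnP => m _ min_m; case: ex_minnP => n /asboolP[T [B [TB Bn]]] _.
pose B' x := [set h | f h \in B x]%SET.
have TB' : tree_decomposition B'.
  case: TB => T_tree vtx edge conn; split=> // [h|h k hk|h].
  - by have [x hx] := vtx (f h); exists x; rewrite inE.
  - by have [x hkx] := edge _ _ (f_homo _ _ hk); exists x; rewrite !inE.
  - suff ->: ([set x | h \in B' x] = [set x | f h \in B x])%SET by [].
    by apply/setP=> x; rewrite !inE.
have: (m <= \max_x #|B' x|)%N by apply: min_m; apply/asboolP; exists T, B'.
have: (\max_x #|B' x| <= n)%N.
  rewrite -Bn; apply/bigmax_leqP => x _; apply: leq_trans (leq_bigmax x).
  rewrite -(card_imset _ f_inj); apply/subset_leq_card/fintype.subsetP => y.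
  by case/imsetP=> h; rewrite inE => hx ->.
lia.
Qed.

Lemma induced_connected (G : sgraph) (S : {set G}) (t : G) (h : G -> nat) :
  t \in S ->
  (forall x, x \in S -> x != t ->
    exists y, [/\ y \in S, x -- y & (h y < h x)%N]) ->
  connected_graph (induced_subgraph S).
Proof.
move=> tS descent; split; first by apply/card_gt0P; exists (exist _ t tS).
pose t' : induced_subgraph S := exist _ t tS.
move=> x y; apply: (@connect_by_descent _ _ predT t' (h \o val)) => //.
  exact: adj_sym.
move=> {}x _ x't; have [y' [y'S xy hyx]] := descent (val x) (valP x) x't.
by exists (exist _ y' y'S).
Qed.

(** * Trees given by a parent function *)

Section ParentTree.
Variables (T : finType) (t : T) (up : T -> T) (h : T -> nat).
Hypothesis up_t : up t = t.
Hypothesis h_up : forall x, x != t -> (h (up x) < h x)%N.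

Definition parent_rel : rel T :=
  fun x y => (x != y) && ((up x == y) || (up y == x)).

Lemma parent_sym : symmetric parent_rel.
Proof. by move=> x y; rewrite /parent_rel eq_sym orbC. Qed.

Lemma parent_irr : irreflexive parent_rel.
Proof. by move=> x; rewrite /parent_rel eqxx. Qed.

Definition parent_tree : sgraph := SGraph parent_sym parent_irr.

Lemma parent_adj (x : parent_tree) : x != t -> x -- up x.
Proof.
move=> x't; rewrite /adj /= /parent_rel eqxx andbT.
by apply/eqP => xE; have := h_up x't; rewrite -xE ltnn.
Qed.

(* In a cycle both neighbours of a node of maximal height are its parent. *)
Lemma parent_treeP : is_tree parent_tree.
Proof.
split; first split; first by apply/card_gt0P; exists t.
  move=> x y; apply: (@connect_by_descent _ _ predT t h) => //.
    exact: parent_sym.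
  move=> {}x _ x't; exists (up x); rewrite h_up //; split=> //.
  exact: parent_adj.
move=> c; case: c => [|x0 c0] // cyc; set c := x0 :: c0 in cyc *.
have [x xc xmax] := @arg_maxnP parent_tree x0 [in c] h (mem_head _ _).
rewrite leqNgt; apply/negP => c_gt2.
have [k s rot_c] := rot_to xc.
have mem_s y : y \in x :: s -> y \in c by rewrite -rot_c mem_rot.
have size_s : (1 < size s)%N by move: c_gt2; rewrite -(size_rot k) rot_c.
case/andP: cyc; rewrite -(rot_cycle k) -(rot_uniq k) rot_c.
have upE (y : parent_tree) : y \in c -> x -- y -> up x = y.
  move=> /xmax yx /andP[x'y /orP[/eqP //|/eqP upy]].
  have [yt|/h_up] := eqVneq y t; first by rewrite -upy yt up_t eqxx in x'y.
  by rewrite upy ltnNge (yx : (h y <= h x)%N).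
case: s size_s mem_s {rot_c} => [|y [|z s]] //= _ mem_s.
rewrite rcons_path => /and4P[xy _ _ lx] /and3P[_ y_notin _].
have l_in : last z s \in z :: s by exact: mem_last.
have/upE: y \in c by apply: mem_s; rewrite !inE eqxx orbT.
move=> /(_ xy) upx; have/upE: last z s \in c.
  by apply: mem_s; rewrite 2!in_cons l_in !orbT.
by rewrite (adj_sym (s := parent_tree)) => /(_ lx) upx';
  rewrite -upx upx' l_in in y_notin.
Qed.

End ParentTree.

(** * Layers *)

Section Layers.
Variable G : sgraph.
Implicit Types x y u v : G.

Lemma connect_adj_sym : connect_sym (@adj G).
Proof. exact: sym_connect_sym (@adj_sym G). Qed.

Definition base x : G := fingraph.root (@adj G) x.

Lemma base_connect x y : connect (@adj G) x y -> base x = base y.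
Proof. by move/(fingraph.rootP connect_adj_sym). Qed.

Lemma base_idem x : base (base x) = base x.
Proof. exact/esym/base_connect/connect_root. Qed.

Lemma base_adj x y : x -- y -> base x = base y.
Proof. by move=> xy; apply/base_connect/connect1. Qed.

Lemma walkP n x y :
  reflect (exists p, [/\ size p = n, path (@adj G) x p & last x p = y])
    (walk n x y).
Proof.
apply: (iffP existsP) => [[p /andP[xp /eqP py]]|[p [pn xp py]]].
  by exists p; rewrite size_tuple.
by exists (tcast pn (in_tuple p)); rewrite val_tcast /= xp py eqxx.
Qed.

Lemma walk_base x : exists n, walk n (base x) x.
Proof.
have /connectP[p xp px] : connect (@adj G) (base x) x.
  by rewrite connect_adj_sym connect_root.
by exists (size p); apply/walkP; exists p.
Qed.

(** The distance from the base of the component, as a minimum over walks of any length. *)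
Definition layer x : nat := ex_minn (walk_base x).

Lemma layer_base x : layer (base x) = 0%N.
Proof.
rewrite /layer; case: ex_minnP => n _ /(_ 0%N) min_n.
apply/eqP; rewrite -leqn0 min_n //; apply/walkP; exists [::].
by rewrite base_idem.
Qed.

Lemma layer0 x : layer x = 0%N -> x = base x.
Proof.
rewrite /layer; case: ex_minnP => n wn _ n0; rewrite {}n0 in wn.
by case/walkP: wn => -[|z p] [].
Qed.

Lemma layer_adj x y : x -- y -> (layer y <= (layer x).+1)%N.
Proof.
rewrite /layer => xy; case: ex_minnP => n _ min_n.
case: ex_minnP => m /walkP[p [pm xp px]] _; apply: min_n; apply/walkP.
exists (rcons p y); rewrite size_rcons pm -(base_adj xy) rcons_path last_rcons.
by rewrite xp px.
Qed.

Lemma layer_pred x :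
  (0 < layer x)%N -> exists y, y -- x /\ (layer y).+1 = layer x.
Proof.
have: walk (layer x) (base x) x by rewrite /layer; case: ex_minnP.
case/walkP=> p; case: (lastP p) => [[<- //]|{}p y []].
rewrite size_rcons rcons_path last_rcons => pn /andP[xp yx] y_x _.
rewrite {}y_x in yx; exists (last (base x) p); split=> //.
have le1 := layer_adj yx; apply/eqP; rewrite eqn_leq le1 andbT -pn ltnS.
rewrite [layer _]/layer; case: ex_minnP => m _; apply; apply/walkP.
by exists p; rewrite (base_adj yx).
Qed.

(** * Classes of the layers and their parents *)

Definition above i : rel G :=
  fun x y => [&& x -- y, (i <= layer x)%N & (i <= layer y)%N].

Lemma above_sym i : connect_sym (above i).
Proof.
apply: sym_connect_sym => x y.
by rewrite /above adj_sym; congr (_ && _); exact: andbC.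
Qed.

Lemma above_sub i j x y :
  (i <= j)%N -> connect (above j) x y -> connect (above i) x y.
Proof.
move=> ij; apply: connect_sub => {x y} x y /and3P[xy jx jy].
by rewrite connect1 // /above xy (leq_trans ij jx) (leq_trans ij jy).
Qed.

Definition same x y : bool :=
  (layer x == layer y) && connect (above (layer x)) x y.

Lemma same_refl x : same x x.
Proof. by rewrite /same eqxx connect0. Qed.

Lemma same_sym : symmetric same.
Proof.
move=> x y; rewrite /same eq_sym; case: eqP => //= ->.
by rewrite above_sym.
Qed.

Lemma same_trans : transitive same.
Proof.
move=> y x z /andP[/eqP xy cxy] /andP[/eqP yz cyz].
by rewrite /same xy yz eqxx -yz (connect_trans _ cyz) // -xy.
Qed.

Lemma same_layer x y : same x y -> layer x = layer y.
Proof. by case/andP=> /eqP. Qed.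

Lemma same_base x y : same x y -> base x = base y.
Proof.
case/andP=> _ xy; apply: base_connect; apply: connect_sub xy.
by move=> z w /and3P[zw _ _]; exact: connect1.
Qed.

(** A canonical choice in the class: [pick] depends only on the predicate, and equivalent vertices
    give the same predicate. *)
Definition rep x : G := odflt x [pick y | same x y].

Lemma same_rep x : same x (rep x).
Proof. by rewrite /rep; case: pickP => [//|/(_ x)]; rewrite same_refl. Qed.

Lemma rep_same x y : same x y -> rep x = rep y.
Proof.
move=> xy; rewrite /rep (eq_pick (Q := same y)).
  by case: pickP => [//|/(_ y)]; rewrite same_refl.
move=> z; apply/idP/idP; apply: same_trans; rewrite // same_sym //.
Qed.

Lemma rep_idem x : rep (rep x) = rep x.
Proof. exact/esym/rep_same/same_rep. Qed.

Definition down x : G :=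
  odflt x [pick y | (y -- x) && ((layer y).+1 == layer x)].

Lemma downP x : (0 < layer x)%N -> down x -- x /\ (layer (down x)).+1 = layer x.
Proof.
move=> /layer_pred[y [yx ly]]; rewrite /down.
case: pickP => [z /andP[zx /eqP lz] //|/(_ y)].
by rewrite yx ly eqxx.
Qed.

(** This makes the parent class well defined: [down x] and [y] are joined by going up to [x],
    through the class to [x'], and down again, never below the layer of [y]. *)
Lemma same_below x x' y :
  same x x' -> y -- x' -> (layer y).+1 = layer x -> same (down x) y.
Proof.
move=> xx' yx' ly; have [|dx ld] := @downP x; first by rewrite -ly.
have lx' := same_layer xx'.
have lE : layer (down x) = layer y by lia.
rewrite /same lE eqxx /=; apply: (@connect_trans _ _ x).
  by apply: connect1; rewrite /above dx lE leqnn /=; lia.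
apply: (@connect_trans _ _ x').
  by case/andP: xx' => _; apply: above_sub; lia.
rewrite above_sym; apply: connect1; rewrite /above yx' leqnn /=; lia.
Qed.

Lemma same_down x y : same x y -> (0 < layer x)%N -> same (down x) (down y).
Proof.
move=> xy lx; have ly := same_layer xy.
have [|dy ldy] := @downP y; first by rewrite -ly.
by apply: same_below xy dy _; rewrite ldy ly.
Qed.

(** * The tree-decomposition into classes with their parents *)

Definition bag (o : option G) : {set G} :=
  if o is Some x
  then [set u | same x u || ((0 < layer x)%N && same (down x) u)]%SET
  else finset.set0.

Definition up (o : option G) : option G :=
  if o is Some x then
    if rep x != x then Some (rep x)
    else if layer x == 0%N then None else Some (rep (down x))
  else None.

(** Doubling the layer leaves room for the other vertices of a class just above its representative;
    the successor keeps [None] at the bottom. *)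
Definition height (o : option G) : nat :=
  if o is Some x then ((layer x).*2 + (rep x != x)).+1 else 0.

Lemma height_up o : o != None -> (height (up o) < height o)%N.
Proof.
case: o => [x _|//] /=; have [xE|x'rep] /= := eqVneq (rep x) x; last first.
  by rewrite rep_idem eqxx -(same_layer (same_rep x)); lia.
case: eqP => [//|lx] /=; have [|_ ld] := @downP x; first by lia.
by rewrite rep_idem eqxx -(same_layer (same_rep (down x))); lia.
Qed.

(* The tree is on option G rather than on classes: a vertex that is not the   *)
(* representative of its class is a leaf attached to the representative, and  *)
(* None, with an empty bag, joins the components of G.                        *)
Definition layer_tree : sgraph := parent_tree up.

Lemma layer_tree_decomposition : @tree_decomposition G layer_tree bag.
Proof.
split.
- by apply: (@parent_treeP _ None up height) => //; exact: height_up.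
- by move=> v; exists (Some v); rewrite inE same_refl.
- move=> u v; wlog le_uv: u v / (layer u <= layer v)%N => [wlg uv|uv].
    have [/wlg|/ltnW/wlg vu] := leqP (layer u) (layer v); first exact.
    by have [|x] := vu; [rewrite adj_sym | exists x; rewrite andbC].
  (* The bag of the upper end [v] works: [u] is in its class or, one layer below, in the parent
     class. *)
  have le_vu := layer_adj uv; exists (Some v); rewrite !inE same_refl andbT.
  have [lE|l'] := eqVneq (layer u) (layer v).
    rewrite /same lE eqxx connect1 //.
    by rewrite /above adj_sym uv lE leqnn.
  apply/orP; right; apply/andP; split; first by lia.
  by apply: (same_below (same_refl v) uv); lia.
(* The nodes whose bag contains [u] come from the class of [u] and its child classes; [up] leads
   from each of them to [rep u] without leaving this set. *)
- move=> u; apply: (@induced_connected layer_tree _ (Some (rep u)) height).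
    by rewrite !inE same_sym same_rep.
  move=> o; rewrite !inE => uo o't.
  have oN : o != None by apply: contraTneq uo => ->; rewrite inE.
  exists (up o); rewrite height_up //; split=> //; last first.
    exact: (parent_adj height_up).
  case: o uo o't {oN} => [x|] /=; rewrite !inE // => ux x't.
  have [xE|_] /= := eqVneq (rep x) x; last first.
    rewrite inE; have xr := same_rep x; case/orP: ux => [xu|/andP[lx du]].
      by apply/orP; left; rewrite same_sym in xr; exact: same_trans xr xu.
    apply/orP; right; rewrite -(same_layer xr) lx /=; apply: same_trans du.
    by rewrite same_sym; exact: same_down xr lx.
  case/orP: ux => [/rep_same xu|/andP[lx du]].
    by rewrite -xu xE eqxx in x't.
  rewrite gtn_eqF // inE; apply/orP; left.
  by apply: same_trans du; rewrite same_sym same_rep.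
Qed.

(** * The minor of radius at most 2 attached to a bag *)

(* The truncated (layer v).-2 also covers the layers 0 and 1, where only the  *)
(* base is merged to the base.                                                *)
Section BagMinor.
Variable v : G.

Definition kept u : bool :=
  [&& base u == base v, (u == base v) || ((layer v).-2 < layer u)%N
    & (layer u <= layer v)%N].

(** Higher layers and other components are deleted. The vertex given to [insub] is always kept, so
    [None] arises only from deletion. *)
Definition shrink u : option {u | kept u} :=
  if (base u == base v) && (layer u <= layer v)%N
  then insub (if (layer u <= (layer v).-2)%N then base v else u) else None.

Definition shrunk_rel : rel {u | kept u} :=
  fun a b => (a != b) &&
    [exists x, exists y, [&& shrink x == Some a, shrink y == Some b & x -- y]].

Lemma shrunk_sym : symmetric shrunk_rel.
Proof.
move=> a b; rewrite /shrunk_rel eq_sym; congr (_ && _).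
by apply/existsP/existsP => -[x /existsP[y /and3P[xa yb xy]]]; exists y;
  apply/existsP; exists x; rewrite xa yb adj_sym xy.
Qed.

Lemma shrunk_irr : irreflexive shrunk_rel.
Proof. by move=> a; rewrite /shrunk_rel eqxx. Qed.

Definition shrunk : sgraph := SGraph shrunk_sym shrunk_irr.

Lemma kept_base : kept (base v).
Proof. by rewrite /kept base_idem !eqxx layer_base. Qed.

Definition center : shrunk := exist _ (base v) kept_base.

Lemma shrink_kept (a : shrunk) : shrink (val a) = Some a.
Proof.
have /and3P[bu lu ul] := valP a; rewrite /shrink bu ul /=.
case: ifP => [ul'|_]; last by rewrite valK.
have aE: val a == base v by move: lu; rewrite ltnNge ul' orbF.
by rewrite -(eqP aE) valK.
Qed.

Lemma shrink_low u :
  base u = base v -> (layer u <= (layer v).-2)%N -> shrink u = Some center.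
Proof.
move=> bu lu; rewrite /shrink bu eqxx lu /=.
have ->: (layer u <= layer v)%N by lia.
exact: (valK center).
Qed.

Lemma shrinkP u (a : shrunk) : shrink u = Some a ->
  [/\ base u = base v, (layer u <= layer v)%N &
    val a = if (layer u <= (layer v).-2)%N then base v else u].
Proof.
rewrite /shrink; case: ifP => // /andP[/eqP bu lu].
by case: insubP => // b _ bE [<-].
Qed.

Lemma shrunk_adj x y (a b : shrunk) :
  shrink x = Some a -> shrink y = Some b -> x -- y -> a != b -> a -- b.
Proof.
move=> xa yb xy a'b; rewrite /adj /= /shrunk_rel a'b.
by apply/existsP; exists x; apply/existsP; exists y; rewrite xa yb !eqxx.
Qed.

Lemma shrunk_model : @model shrunk G shrink.
Proof.
split=> [a|x y xy|a b /andP[_ /existsP[x /existsP[y /and3P[xa yb xy]]]]].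
- by exists (val a); rewrite shrink_kept.
- case xa: (shrink x) => [a|] // _; have ya := xa; rewrite xy in ya.
  have [bx lx ax] := shrinkP xa; have [by_ ly ay] := shrinkP ya.
  (* Away from the center a branch set is a single vertex; at the center it consists of the low
     layers, in which [down] leads to the base. *)
  have [aE|a'] := eqVneq (val a) (base v); last first.
    move: a'; rewrite {1}ax; case: ifP => [_|xlow]; first by rewrite eqxx.
    rewrite xlow in ax; move: ay; rewrite {1}ax; case: ifP => [_ ->|_ ->].
      by rewrite eqxx.
    by rewrite connect0.
  pose low : pred G :=
    [pred u | (base u == base v) && (layer u <= (layer v).-2)%N].
  have lowP u : base u = base v ->
      (val a = if (layer u <= (layer v).-2)%N then base v else u) -> low u.
    move=> bu; rewrite /low /= bu eqxx aE; case: leqP => //= lu uE.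
    by rewrite -uE layer_base in lu.
  apply: (@connect_by_descent _ _ low (base v) layer); try exact: lowP.
    by move=> z w; rewrite /fiber_rel eq_sym adj_sym.
  move=> u /andP[/eqP bu lu] u'; have [|du ld] := @downP u.
    by rewrite lt0n; apply: contra_neq u' => /layer0 ->.
  have bd : base (down u) = base v by rewrite (base_adj du).
  exists (down u); split; last by lia.
    by rewrite /low /= bd eqxx /=; lia.
  by rewrite /fiber_rel adj_sym du !shrink_low ?eqxx //; lia.
- by exists x, y; split=> //; apply/eqP.
Qed.

Lemma shrunk_descent (a : shrunk) : a != center ->
  exists b : shrunk, [/\ a -- b, (layer (val b) < layer (val a))%N &
    b = center \/
    (layer (val a) = (layer v).-2.+2 /\ layer (val b) = (layer v).-2.+1)].
Proof.
move=> a'; have /and3P[/eqP ba la al] := valP a.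
have a'v : val a != base v by apply: contraNneq a' => av; apply/eqP/val_inj.
rewrite (negPf a'v) orFb in la.
have [|da ld] := @downP (val a); first by lia.
have bd : base (down (val a)) = base v by rewrite (base_adj da).
have [dlow|dhigh] := leqP (layer (down (val a))) (layer v).-2.
  exists center; split; [|by rewrite (layer_base v); lia|by left].
  rewrite adj_sym; apply: shrunk_adj da _; last by rewrite eq_sym.
    exact: shrink_low.
  exact: shrink_kept.
have dl : (layer (down (val a)) <= layer v)%N by lia.
have dk : kept (down (val a)) by rewrite /kept bd eqxx dhigh orbT dl.
pose d : shrunk := exist _ (down (val a)) dk.
exists d; split; [|by rewrite -ld|right; rewrite -[val d]/(down (val a)); lia].
have d'a : d != a.
  apply/eqP => /(congr1 val) dE.
  by move: da; rewrite -[down _]/(val d) dE adj_irr.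
rewrite adj_sym; apply: shrunk_adj da d'a; last exact: shrink_kept.
exact: (shrink_kept d).
Qed.

Lemma shrunk_connected : connected_graph shrunk.
Proof.
split; first by apply/card_gt0P; exists center.
move=> a b; apply: (@connect_by_descent _ _ predT center (layer \o val)) => //.
  exact: adj_sym.
by move=> {}a _ /shrunk_descent[c [ac lac _]]; exists c.
Qed.

End BagMinor.

End Layers.

(** * Radius bound and embedding of the bag *)

Lemma dist_le (G : sgraph) (n : nat) (x y : G) :
  walk n x y -> (dist x y <= n)%N.
Proof.
(* For [n] outside the searched range, the default value [#|G|] of [dist] is already small
   enough. *)
move=> wn; rewrite /dist; have [le_n|lt_n] := leqP #|G| n.
  by apply: leq_trans le_n; rewrite -[X in (_ <= X)%N](size_iota 0) find_size.
rewrite leqNgt; apply/negP => /(before_find 0%N).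
by rewrite nth_iota // wn.
Qed.

Lemma bigminn_leq (T : finType) (m : nat) (F : T -> nat) (a : T) :
  (\big[minn/m]_(x : T) F x <= F a)%N.
Proof.
elim: (index_enum T) (mem_index_enum a) => // b s IHs.
rewrite inE big_cons geq_min => /orP[/eqP<-|/IHs->]; last exact: orbT.
by rewrite leqnn.
Qed.

Lemma graph_radius_le (G : sgraph) (r : nat) (a : G) :
  (forall x, dist a x <= r)%N -> (graph_radius G <= r)%N.
Proof.
move=> ar; apply: (@leq_trans (\max_(x : G) dist a x)); last exact/bigmax_leqP.
exact: (bigminn_leq _ (fun b => \max_(x : G) dist b x)).
Qed.

Lemma shrunk_radius (G : sgraph) (v : G) : (graph_radius (shrunk v) <= 2)%N.
Proof.
apply: (@graph_radius_le _ _ (center v)) => a.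
have [->|/shrunk_descent[b [ab _ bP]]] := eqVneq a (center v).
  by apply: (@leq_trans 0) => //; apply: dist_le; apply/walkP; exists [::].
have [bE|b'] := eqVneq b (center v).
  apply: (@leq_trans 1) => //; apply: dist_le; apply/walkP; exists [:: a].
  by split=> //=; rewrite andbT -bE; rewrite adj_sym in ab.
case: bP => [bE|[_ lb]]; first by rewrite bE eqxx in b'.
have [c [bc _ [cE|[lb' _]]]] := shrunk_descent b'; last by lia.
apply: dist_le; apply/walkP; exists [:: b; a].
by rewrite cE adj_sym in bc; rewrite adj_sym in ab; split=> //; apply/and3P.
Qed.

Lemma bag_shrunk (G : sgraph) (v : G) :
  subgraph (induced_subgraph (bag (Some v))) (shrunk v).
Proof.
have bag_kept u : u \in bag (Some v) -> kept v u.
  rewrite inE /kept => /orP[vu|/andP[lv du]].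
    have lu := same_layer vu; rewrite -(same_base vu) eqxx -lu leqnn andbT /=.
    (* The strict bound on layers in [kept] fails only in layer 0, where the vertex is the base
       itself. *)
    case: (posnP (layer v)) => [l0|]; last by move=> lv; apply/orP; right; lia.
    by rewrite (same_base vu) -layer0 ?eqxx // -lu.
  have [dv ld] := downP lv; have lu := same_layer du.
  have bu : base u = base v by rewrite -(same_base du) (base_adj dv).
  rewrite bu eqxx -lu /=; apply/andP; split; last by lia.
  case: (posnP (layer u)) => [l0|]; last by move=> ?; apply/orP; right; lia.
  by rewrite -bu -layer0 ?eqxx.
pose f (x : induced_subgraph (bag (Some v))) : shrunk v :=
  exist _ (val x) (bag_kept _ (valP x)).
exists f => [x y /(congr1 val) /= xy|x y xy]; first exact: val_inj.
have vxy : (val x : G) -- val y by [].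
apply: (shrunk_adj (shrink_kept (f x)) (shrink_kept (f y)) vxy).
by apply: contraTneq vxy => /(congr1 val) vE;
  rewrite -[val x]/(val (f x)) vE adj_irr.
Qed.

(** * From bags to tree-treewidth *)

Lemma treewidth_ge_m1 (G : sgraph) : (-1 <= treewidth G)%R.
Proof. rewrite /treewidth; lia. Qed.

Lemma treewidth_null (G : sgraph) : #|G| = 0%N -> treewidth G = (-1)%R.
Proof.
move=> G0; rewrite /treewidth; case: ex_minnP => m _ min_m.
suff: (m <= 0)%N by lia.
have [T [B [TB BT]]] := trivial_tree_decomposition G.
apply: min_m; apply/asboolP; exists T, B; split=> //.
apply/eqP; rewrite -leqn0; apply/bigmax_leqP => x _.
by rewrite BT cardsT G0.
Qed.

Lemma tree_treewidth_le (G : sgraph) (k : int) :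
  (-1 <= k)%R -> has_bags_of_treewidth_le G k -> (tree_treewidth G <= k)%R.
Proof.
move=> k_ge Gk; rewrite /tree_treewidth; case: ex_minnP => m _ min_m.
have kE : k = (`|(k + 1)%R|%N%:Z - 1)%R by lia.
suff: (m <= `|(k + 1)%R|)%N by lia.
by apply: min_m; apply/asboolP; rewrite -kE.
Qed.

Theorem theorem16 (R : realType) (A : sgraph) (hA : apex R A)
    (G : sgraph) (hG : minor_free A G)
    (g : int) (hg : is_g A 2 g) :
  (tree_treewidth G <= g)%R.
Proof.
(* A graph that attains the maximum gives $g \geq -1$, which covers the empty bag at [None]. *)
have [[H _ <-] tw_g] := hg; have g_ge := treewidth_ge_m1 H.
apply: tree_treewidth_le => //.
exists (layer_tree G), (@bag G); split; first exact: layer_tree_decomposition.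
case=> [v|]; last first.
  by rewrite treewidth_null // card_sig; apply: eq_card0 => x; rewrite !inE.
apply: Order.POrderTheory.le_trans (treewidth_subgraph (bag_shrunk v)) _.
apply: tw_g.
split; [|exact: shrunk_connected|exact: shrunk_radius].
case/minor_model=> psi psiM; apply: hG.
exact: model_minor (model_comp (shrunk_model v) psiM).
Qed.
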